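(* For every integer $n\ge 0$, $$C_{n+1}^2=\sum_{k=0}^{n}\frac{(2k+1)(2k+3)(8nk+2n+10k+4)}{(2n+1)(2n+2)(2n+3)(2n+4)(2n+5)}\binom{2n+2}{n-k}\binom{2n+5}{n-k+2},$$ $$C_{n}C_{n+1}=\sum_{k=0}^{n}\frac{(2k+1)(2k+2)(2k+3)}{(2n+1)(2n+2)(2n+3)^2}\binom{2n+3}{n-k}\binom{2n+3}{n-k+1},$$ $$C_{n}C_{n+2}=\sum_{k=0}^{n}\frac{(2k+1)(2k+3)(8nk+14n+10k+16)}{(2n+1)(2n+2)(2n+3)(2n+4)(2n+5)}\binom{2n+2}{n-k}\binom{2n+5}{n-k+1}.$$
   Context: $C_n=\frac{1}{n+1}\binom{2n}{n}$ is the $n$-th Catalan number. *)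

(* Defs.v *)
From mathcomp Require Import all_boot all_order all_algebra.

Set Implicit Arguments.
Unset Strict Implicit.
Unset Printing Implicit Defensive.

Import GRing.Theory Num.Theory.

Local Open Scope ring_scope.

Definition catalan (n : nat) : rat := (n + 1)%N%:R^-1 * 'C(2 * n, n)%N%:R.

(* Main.v *)
(** Each summand is hypergeometric in k and Gosper-summable: writing it as
    P(k) C(N, n-k) C(M, n-k+s) with N, M, s independent of k, there is a
    polynomial f, quadratic in k, with
      P(k) = f(k) (N-n+k) (M-n-s+k) - f(k+1) (n-k) (n-k+s),
    so the sum telescopes, vanishes at the upper end, and its value at k = 0 is
    a product of two binomial coefficients proportional to the Catalan product. *)
Require Import Defs.
From mathcomp Require Import all_boot all_order all_algebra.
From mathcomp Require Import ring lra zify.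
Import GRing.Theory Num.Theory.
Local Open Scope ring_scope.

Lemma bin_factR (a b : nat) :
  'C(a + b, a)%:R = (a + b)`!%:R / (a`!%:R * b`!%:R) :> rat.
Proof.
have fact_neq0 c : c`!%:R != 0 :> rat by rewrite pnatr_eq0 -lt0n fact_gt0.
have := bin_fact (leq_addr b a); rewrite addKn => <-.
by rewrite !natrM mulfK // mulf_neq0.
Qed.

(* Reflecting C(n + p, n - k) into C(n + p, p + k) makes the antidifference
   vanish at k = n + 1, despite the truncated subtraction n - k. *)
Lemma sum_bin_bin_telescope (n p s q N M : nat) (f P : nat -> rat) :
    N = (n + p)%N -> M = (n + s + q)%N ->
    (forall k, P k = f k * (p + k)%:R * (q + k)%:R
                     - f k.+1 * (n%:R - k%:R) * (n%:R - k%:R + s%:R)) ->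
  \sum_(0 <= k < n.+1) P k * 'C(N, n - k)%:R * 'C(M, n - k + s)%:R
  = f 0%N * p%:R * q%:R * 'C(n + p, n)%:R * 'C(n + s + q, n + s)%:R.
Proof.
move=> -> -> PE.
(* For [k <= n], [T k - T k.+1] is the [k]-th summand; the hypothesis on [P] is this identity with
   the common binomials cancelled. *)
pose T k := f k * (p + k)%:R * (q + k)%:R
            * 'C(n + p, p + k)%:R * 'C(n + s + q, q + k)%:R.
have T0 : T 0%N
    = f 0%N * p%:R * q%:R * 'C(n + p, n)%:R * 'C(n + s + q, n + s)%:R.
  rewrite /T !addn0 -(bin_sub (leq_addr p n)) -(bin_sub (leq_addr q (n + s))).
  by rewrite !addKn.
have Tn : T n.+1 = 0 by rewrite /T (@bin_small (n + p)) ?mulr0 ?mul0r //; lia.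
have T0_sum : T 0%N = \sum_(0 <= k < n.+1) - (T k.+1 - T k).
  by rewrite sumrN telescope_sumr // Tn sub0r opprK.
rewrite -T0 T0_sum; apply: eq_big_nat => k /andP[_ lekn].
have Cp : 'C(n + p, n - k) = 'C(n + p, p + k).
  by rewrite -[LHS]bin_sub; [congr 'C(_, _)|]; lia.
have Cq : 'C(n + s + q, n - k + s) = 'C(n + s + q, q + k).
  by rewrite -[LHS]bin_sub; [congr 'C(_, _)|]; lia.
(* Absorption: the factors [p + k.+1] and [q + k.+1] of [T k.+1] lower its binomials to those of
   [T k], leaving [n - k] and [n - k + s]. *)
have Sp : (p + k.+1)%:R * 'C(n + p, p + k.+1)%:R
    = (n%:R - k%:R) * 'C(n + p, p + k)%:R :> rat.
  rewrite addnS -natrM mul_bin_left natrM -natrB; last lia.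
  by congr (_%:R * _); lia.
have Sq : (q + k.+1)%:R * 'C(n + s + q, q + k.+1)%:R
    = (n%:R - k%:R + s%:R) * 'C(n + s + q, q + k)%:R :> rat.
  rewrite addnS -natrM mul_bin_left natrM -natrB; last lia.
  by rewrite -natrD; congr (_%:R * _); lia.
rewrite PE Cp Cq /T opprB.
transitivity (f k * (p + k)%:R * (q + k)%:R * 'C(n + p, p + k)%:R
    * 'C(n + s + q, q + k)%:R
  - f k.+1 * ((p + k.+1)%:R * 'C(n + p, p + k.+1)%:R)
    * ((q + k.+1)%:R * 'C(n + s + q, q + k.+1)%:R)); last by ring.
by rewrite Sp Sq; ring.
Qed.

Theorem corollary3p4 (n : nat) :
  [/\ catalan (n + 1) ^+ 2 =
        \sum_(0 <= k < n.+1)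
          ((2 * k + 1) * (2 * k + 3) * (8 * n * k + 2 * n + 10 * k + 4))%N%:R
          / ((2 * n + 1) * (2 * n + 2) * (2 * n + 3) * (2 * n + 4)
             * (2 * n + 5))%N%:R
          * 'C(2 * n + 2, n - k)%N%:R * 'C(2 * n + 5, n - k + 2)%N%:R,
      catalan n * catalan (n + 1) =
        \sum_(0 <= k < n.+1)
          ((2 * k + 1) * (2 * k + 2) * (2 * k + 3))%N%:R
          / ((2 * n + 1) * (2 * n + 2) * (2 * n + 3) ^ 2)%N%:R
          * 'C(2 * n + 3, n - k)%N%:R * 'C(2 * n + 3, n - k + 1)%N%:R
    & catalan n * catalan (n + 2) =
        \sum_(0 <= k < n.+1)
          ((2 * k + 1) * (2 * k + 3)
           * (8 * n * k + 14 * n + 10 * k + 16))%N%:R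
          / ((2 * n + 1) * (2 * n + 2) * (2 * n + 3) * (2 * n + 4)
             * (2 * n + 5))%N%:R
          * 'C(2 * n + 2, n - k)%N%:R * 'C(2 * n + 5, n - k + 1)%N%:R].
Proof.
have n_ge0 : 0 <= n%:R :> rat by [].
have fact_neq0 c : c`!%:R != 0 :> rat by rewrite pnatr_eq0 -lt0n fact_gt0.
have catE m : catalan m = (2 * m)`!%:R / ((m + 1)%:R * m`!%:R * m`!%:R).
  have m_ge0 : 0 <= m%:R :> rat by [].
  rewrite /catalan mul2n -addnn bin_factR.
  by field; rewrite fact_neq0 /=; apply: lt0r_neq0; lra.
(* Every factorial is reduced to [(2 * n)!] and [n!], so that the boundary values become rational
   identities for [field]. *)
have fact2S : (2 * (n + 1))`!%:R
    = (2 * n%:R + 2) * (2 * n%:R + 1) * (2 * n)`!%:R :> rat.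
  by rewrite (_ : 2 * (n + 1) = (2 * n).+2)%N ?factS; [ring|lia].
have factDS a b : (a + b.+1)`!%:R = (a%:R + b%:R + 1) * (a + b)`!%:R :> rat.
  by rewrite addnS factS natrM; congr (_ * _); ring.
have fact2SS : (2 * (n + 2))`!%:R = (2 * n%:R + 4) * (2 * n%:R + 3)
    * (2 * n%:R + 2) * (2 * n%:R + 1) * (2 * n)`!%:R :> rat.
  by rewrite (_ : 2 * (n + 2) = (2 * n).+4)%N ?factS; [ring|lia].
split.
(* Here [p = N - n] and [q = M - n - s]. The quartic terms in [k] cancel, so a quadratic [f] fits
   the cubic [P]; undetermined coefficients give [f]. Its leading coefficient gets multiplied by
   [p + q + 2n + s - 2 = 4n + 5], hence the 8. *)
- rewrite (@sum_bin_bin_telescope n (n + 2) 2 (n + 3) _ _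
    (fun k => (8 * k%:R ^+ 2 + 4 * k%:R + 4 * n%:R + 2)
      / ((2 * n + 1) * (2 * n + 2) * (2 * n + 3) * (2 * n + 4)
         * (2 * n + 5))%N%:R)); try lia.
    rewrite !bin_factR !catE.
    have -> : (n + (n + 2) = 2 * n + 2)%N by lia.
    have -> : (n + 2 + (n + 3) = 2 * n + 5)%N by lia.
    rewrite ?fact2S ?fact2SS !factDS !addn0; field.
    by rewrite fact_neq0 /=; do ?[apply/andP; split]; apply: lt0r_neq0; lra.
  move=> k; field.
  by do ?[apply/andP; split]; apply: lt0r_neq0; lra.
(* The multiplier is now [4n + 4], against 8 in the summand, whence the division by [n + 1]. *)
- rewrite (@sum_bin_bin_telescope n (n + 3) 1 (n + 2) _ _
    (fun k => (2 * k%:R ^+ 2 + 2 * k%:R + n%:R + 1) / (n + 1)%:R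
      / ((2 * n + 1) * (2 * n + 2) * (2 * n + 3) ^ 2)%N%:R)); try lia.
    rewrite !bin_factR !catE.
    have -> : (n + (n + 3) = 2 * n + 3)%N by lia.
    have -> : (n + 1 + (n + 2) = 2 * n + 3)%N by lia.
    rewrite ?fact2S ?fact2SS !factDS !addn0; field.
    by rewrite fact_neq0 /=; do ?[apply/andP; split]; apply: lt0r_neq0; lra.
  move=> k; field.
  by do ?[apply/andP; split]; apply: lt0r_neq0; lra.
(* The multiplier is again [4n + 5]; at [k = 0] the numerator of [f] is [2(2n + 3)], cancelling a
   factor of the denominator. *)
- rewrite (@sum_bin_bin_telescope n (n + 2) 1 (n + 4) _ _
    (fun k => (8 * k%:R ^+ 2 + 12 * k%:R + 4 * n%:R + 6)
      / ((2 * n + 1) * (2 * n + 2) * (2 * n + 3) * (2 * n + 4)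
         * (2 * n + 5))%N%:R)); try lia.
    rewrite !bin_factR !catE.
    have -> : (n + (n + 2) = 2 * n + 2)%N by lia.
    have -> : (n + 1 + (n + 4) = 2 * n + 5)%N by lia.
    rewrite ?fact2S ?fact2SS !factDS !addn0; field.
    by rewrite fact_neq0 /=; do ?[apply/andP; split]; apply: lt0r_neq0; lra.
  move=> k; field.
  by do ?[apply/andP; split]; apply: lt0r_neq0; lra.
Qed.
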